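(* Let $d\ge 1$ and let $\mathcal{D}:[0,1]^d\times[0,1]^d\to[0,1]^d$ be the disjunction operator given either by product logic, $\mathcal{D}(\mathbf{S},\mathbf{T})=\mathbf{S}+\mathbf{T}-\mathbf{S}\circ\mathbf{T}$ (with $\circ$ element-wise multiplication), or by Gödel logic, $\mathcal{D}(\mathbf{S},\mathbf{T})=\max(\mathbf{S},\mathbf{T})$ (element-wise maximum). For queries $q_1,q_2,q_3$ with embeddings $\mathbf{S}_{q_1},\mathbf{S}_{q_2},\mathbf{S}_{q_3}\in[0,1]^d$, the embedding of a disjunction is $\mathbf{S}_{q\vee q'}=\mathcal{D}(\mathbf{S}_q,\mathbf{S}_{q'})$. Then, for either choice of $\mathcal{D}$, for all queries $q_1,q_2,q_3$ (with arbitrary embeddings in $[0,1]^d$) and every entity $e$ with entity embedding $\mathbf{p}_e$, the score $\phi(q,e)=\mathbf{S}_q^{\intercal}\mathbf{p}_e$ satisfies: (i) (commutativity) $\phi(q_1\vee q_2,e)=\phi(q_2\vee q_1,e)$; (ii) (associativity) $\phi((q_1\vee q_2)\vee q_3,e)=\phi(q_1\vee(q_2\vee q_3),e)$; (iii) (disjunction amplification) $\phi(q_1,e)\le\phi(q_1\vee q_2,e)$ and $\phi(q_2,e)\le\phi(q_1\vee q_2,e)$.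
   Context: Each query $q$ is represented by an embedding $\mathbf{S}_q\in[0,1]^d$ (a fuzzy vector). Each entity $e$ is represented by an embedding $\mathbf{p}_e\in[0,1]^d$, normalized so that $\sum_{i=1}^d\mathbf{p}_e(i)=1$ (alternatively, the $L_2$ normalization $\sum_{i=1}^d\mathbf{p}_e(i)^2=1$ may be used). The score of an entity $e$ for a query $q$ is $\phi(q,e)=\mathbf{S}_q^{\intercal}\mathbf{p}_e=\sum_{i=1}^d\mathbf{S}_q(i)\,\mathbf{p}_e(i)$. Embeddings of compound queries are computed recursively from the embeddings of their sub-queries using the logical operators, with $\mathcal{D}$ used for $\vee$. *)

(* Defs.v *)
From HB Require Import structures.
From mathcomp Require Import all_boot all_order all_algebra.
From mathcomp Require Import reals ring.

Set Implicit Arguments.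
Unset Strict Implicit.
Unset Printing Implicit Defensive.

Import Order.TTheory GRing.Theory Num.Theory.
Local Open Scope ring_scope.

Definition in_unit_cube (R : realType) (d : nat) : pred 'cV[R]_d :=
  fun v => [forall i, 0 <= v i 0 <= 1].

(* The cube [0,1]^d. Membership is boolean, hence proof-irrelevant: two points
   are equal as soon as their underlying vectors are. *)
Record unit_cube (R : realType) (d : nat) := UnitCube {
  cube_vec :> 'cV[R]_d;
  cube_vecP : in_unit_cube cube_vec
}.

HB.instance Definition _ (R : realType) (d : nat) :=
  [isSub for @cube_vec R d].

Definition product_or_vec (R : realType) (d : nat) (S T : 'cV[R]_d) :
    'cV[R]_d :=
  S + T - map2_mx *%R S T.

Definition godel_or_vec (R : realType) (d : nat) (S T : 'cV[R]_d) :
    'cV[R]_d :=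
  map2_mx Num.max S T.

Fact product_or_in_cube (R : realType) (d : nat) (S T : unit_cube R d) :
  in_unit_cube (product_or_vec S T).
Proof.
apply/forallP => i; rewrite !mxE.
case/andP: (forallP (cube_vecP S) i) => s0 s1.
case/andP: (forallP (cube_vecP T) i) => t0 t1.
apply/andP; split.
  suff -> : S i 0 + T i 0 - S i 0 * T i 0 = S i 0 + T i 0 * (1 - S i 0).
    by rewrite addr_ge0 ?mulr_ge0 ?subr_ge0.
  by ring.
rewrite -subr_ge0.
suff -> : 1 - (S i 0 + T i 0 - S i 0 * T i 0) = (1 - S i 0) * (1 - T i 0).
  by rewrite mulr_ge0 ?subr_ge0.
by ring.
Qed.

Fact godel_or_in_cube (R : realType) (d : nat) (S T : unit_cube R d) :
  in_unit_cube (godel_or_vec S T).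
Proof.
apply/forallP => i; rewrite !mxE.
case/andP: (forallP (cube_vecP S) i) => s0 s1.
case/andP: (forallP (cube_vecP T) i) => t0 t1.
by rewrite le_max s0 ge_max s1 t1.
Qed.

Inductive fuzzy_logic := ProductLogic | GodelLogic.

Definition fuzzy_or (R : realType) (d : nat) (l : fuzzy_logic)
    (S T : unit_cube R d) : unit_cube R d :=
  match l with
  | ProductLogic => UnitCube (product_or_in_cube S T)
  | GodelLogic => UnitCube (godel_or_in_cube S T)
  end.

Inductive normalization := L1 | L2.

(* The entries of [p] are nonnegative, so no absolute value is needed for L1. *)
Definition normalized (R : realType) (d : nat) (n : normalization)
    (p : unit_cube R d) : Prop :=
  match n with
  | L1 => \sum_(i < d) p i 0 = 1
  | L2 => \sum_(i < d) p i 0 ^+ 2 = 1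
  end.

Definition score (R : realType) (d : nat) (S p : unit_cube R d) : R :=
  (S^T *m p) 0 0.

(* Main.v *)
Require Import Defs.
From mathcomp Require Import all_boot all_order all_algebra.
From mathcomp Require Import reals ring.

Set Implicit Arguments.
Unset Strict Implicit.
Unset Printing Implicit Defensive.

Import Order.TTheory GRing.Theory Num.Theory.
Local Open Scope ring_scope.

(** The score depends on a compound query only through its embedding, so (i) and (ii) already hold
    for embeddings ([fuzzy_orC], [fuzzy_orA]). For (iii), a disjunction dominates its operands in
    every coordinate ([le_fuzzy_orl]), and a weighted sum with nonnegative weights preserves this
    order ([ler_score]). *)

Lemma fuzzy_orC (R : realType) (d : nat) (l : fuzzy_logic) :
  commutative (@fuzzy_or R d l).
Proof.
(* What remains is a scalar law in each coordinate: a polynomial identity for product logic, a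
   lattice law of max for Gödel logic. *)
move=> S T; apply: val_inj; apply/matrixP => i j.
by case: l; rewrite /= !mxE; [ring | rewrite maxC].
Qed.

Lemma fuzzy_orA (R : realType) (d : nat) (l : fuzzy_logic) :
  associative (@fuzzy_or R d l).
Proof.
move=> S T U; apply: val_inj; apply/matrixP => i j.
by case: l; rewrite /= !mxE; [ring | rewrite maxA].
Qed.

Lemma le_fuzzy_orl (R : realType) (d : nat) (l : fuzzy_logic)
    (S T : unit_cube R d) (i : 'I_d) :
  S i 0 <= fuzzy_or l S T i 0.
Proof.
case: l; rewrite /= !mxE; last by rewrite le_max lexx.
have /andP[_ s1] := forallP (cube_vecP S) i.
have /andP[t0 _] := forallP (cube_vecP T) i.
rewrite -subr_ge0.
(* The gain over [S i 0] factors into terms that are nonnegative on the unit interval. *)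
have -> : S i 0 + T i 0 - S i 0 * T i 0 - S i 0 = T i 0 * (1 - S i 0) by ring.
by rewrite mulr_ge0 ?subr_ge0.
Qed.

(** The entries of [p] are nonnegative weights, so the sums compare term by term. *)
Lemma ler_score (R : realType) (d : nat) (S T p : unit_cube R d) :
  (forall i, S i 0 <= T i 0) -> score S p <= score T p.
Proof.
move=> leST; rewrite /score !mxE; apply: ler_sum => i _; rewrite !mxE.
by have /andP[p0 _] := forallP (cube_vecP p) i; rewrite ler_wpM2r.
Qed.

Theorem proposition2 (R : realType) (d : nat) (d_ge1 : (1 <= d)%N)
    (l : fuzzy_logic) (n : normalization)
    (Query : Type) (q_or : Query -> Query -> Query)
    (S : Query -> unit_cube R d)
    (S_or : forall q q' : Query, S (q_or q q') = fuzzy_or l (S q) (S q'))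
    (Entity : Type) (p : Entity -> unit_cube R d)
    (p_normalized : forall e : Entity, normalized n (p e)) :
  let phi (q : Query) (e : Entity) : R := score (S q) (p e) in
  forall (q1 q2 q3 : Query) (e : Entity),
    [/\ phi (q_or q1 q2) e = phi (q_or q2 q1) e,
        phi (q_or (q_or q1 q2) q3) e = phi (q_or q1 (q_or q2 q3)) e &
        phi q1 e <= phi (q_or q1 q2) e /\ phi q2 e <= phi (q_or q1 q2) e].
Proof.
move=> phi q1 q2 q3 e; rewrite /phi !S_or; split.
- by rewrite fuzzy_orC.
- by rewrite fuzzy_orA.
- split; first by apply: ler_score => i; apply: le_fuzzy_orl.
  (* Commutativity moves [q2] to the left, where [le_fuzzy_orl] applies. *)
  by rewrite fuzzy_orC; apply: ler_score => i; apply: le_fuzzy_orl.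
Qed.
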